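(* Let $\mathbf{C}$ and $\mathbf{D}$ be small Cartesian categories, $\Box_{\mathbf{C}}:\mathbf{C}\to\mathbf{C}$ and $\Box_{\mathbf{D}}:\mathbf{D}\to\mathbf{D}$ Cartesian comonads, and let $\Box_{\mathbf{C}}\hookrightarrow\Box_{\mathbf{D}}$ be a dense Cartesian full inclusion of Cartesian comonads. If all split monomorphisms of $\mathbf{D}$ are locally $\mathbf{C}$-small, then all split monomorphisms of $\mathbf{D}^{\Box_{\mathbf{D}}}$ are locally $\mathbf{C}^{\Box_{\mathbf{C}}}$-small, and the Cartesian full subcategory inclusion $\mathbf{C}^{\Box_{\mathbf{C}}}\hookrightarrow\mathbf{D}^{\Box_{\mathbf{D}}}$ between the categories of coalgebras is dense.
   Context: A Cartesian category is a category equipped with a choice of finite limits; a Cartesian functor preserves finite limits; a Cartesian comonad is a comonad whose underlying functor is Cartesian. A full subcategory $\mathbf{C}$ of a Cartesian category $\mathbf{D}$ is a Cartesian full subcategory if it is closed under the chosen finite limits. Limits in categories of coalgebras for a Cartesian comonad are chosen so that the forgetful functor preserves the choice strictly. For $\mathbf{C}$ a Cartesian full subcategory of $\mathbf{D}$, a morphism $p:E\to B$ of $\mathbf{D}$ is locally $\mathbf{C}$-small if for every $A\in\mathbf{C}$ and $f:A\to B$ there is a pullback of $p$ along $f$ whose vertex lies in $\mathbf{C}$ (by convention, the chosen pullback $f^*E$ then lies in $\mathbf{C}$). A functor $F:\mathbf{C}\to\mathbf{D}$ between small categories is dense if for all $I,X\in\mathbf{D}$ the map $\mathrm{Hom}_{\mathbf{D}}(I,X)\to\mathrm{Nat}(\mathrm{Hom}_{\mathbf{D}}(F(-),I),\mathrm{Hom}_{\mathbf{D}}(F(-),X))$,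 $g\mapsto(f\mapsto g\circ f)$, is bijective (equivalently, every object $D$ is, canonically, the colimit of $F\downarrow D\to\mathbf{C}\to\mathbf{D}$). A Cartesian functor $G:\mathbf{D}\to\mathbf{F}$ is a morphism of sites $(\mathbf{D},\mathbf{C})\to(\mathbf{F},\mathbf{E})$, where $\mathbf{C}\subseteq\mathbf{D}$, $\mathbf{E}\subseteq\mathbf{F}$ are Cartesian full subcategories, if for every $D\in\mathbf{D}$ and $f:E\to GD$ in $\mathbf{F}$ with $E\in\mathbf{E}$ there is $g:C\to D$ in $\mathbf{D}$ with $C\in\mathbf{C}$ such that $f$ factors through $Gg$. A Cartesian full inclusion of Cartesian comonads $i:\Box_{\mathbf{C}}\hookrightarrow\Box_{\mathbf{D}}$ is a Cartesian full subcategory inclusion $i:\mathbf{C}\hookrightarrow\mathbf{D}$ that is a strict morphism of comonads: $i\Box_{\mathbf{C}}=\Box_{\mathbf{D}}i$, compatibly with counits and comultiplications. It induces the full subcategory inclusion $\mathbf{C}^{\Box_{\mathbf{C}}}\hookrightarrow\mathbf{D}^{\Box_{\mathbf{D}}}$, $(A,a)\mapsto(iA,ia)$. It is called dense if $i:\mathbf{C}\hookrightarrow\mathbf{D}$ is a dense functor and $\Box_{\mathbf{D}}$ is a morphism of sites $(\mathbf{D},\mathbf{C})\to(\mathbf{D},\mathbf{C})$. *)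

(* Defs.v *)
From Stdlib Require Import ssreflect List ProofIrrelevance FunctionalExtensionality.
From Stdlib Require Import IndefiniteDescription.

Set Implicit Arguments.
Unset Strict Implicit.
Unset Printing Implicit Defensive.

Definition injective_map (A B : Type) (f : A -> B) : Prop :=
  forall x y, f x = f y -> x = y.

Definition bijective_map (A B : Type) (f : A -> B) : Prop :=
  injective_map f /\ forall y, exists x, f x = y.

(* Small categories: objects and morphisms form types, and equality of
   morphisms (and of objects, where strictness is at stake) is Leibniz
   equality. *)
Record Category := {
  Ob :> Type;
  Hom : Ob -> Ob -> Type;
  idm : forall A, Hom A A;
  comp : forall A B C, Hom B C -> Hom A B -> Hom A C;
  comp_idl : forall A B (f : Hom A B), comp (idm B) f = f;
  comp_idr : forall A B (f : Hom A B), comp f (idm A) = f;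
  comp_assoc : forall A B C D (h : Hom C D) (g : Hom B C) (f : Hom A B),
    comp h (comp g f) = comp (comp h g) f }.

Arguments Hom {c} _ _.
Arguments idm {c} A.
Arguments comp {c A B C} g f.
Notation "g ∘ f" := (comp g f) (at level 40, left associativity).

Record Functor (C D : Category) := {
  fob :> C -> D;
  fmap : forall A B : C, Hom A B -> Hom (fob A) (fob B);
  fmap_id : forall A, fmap (idm A) = idm (fob A);
  fmap_comp : forall (A B E : C) (g : Hom B E) (f : Hom A B),
    fmap (g ∘ f) = fmap g ∘ fmap f }.

Arguments fmap {C D} f {A B} _ : rename.

Lemma fcomp_id (C D E : Category) (G : Functor D E) (F : Functor C D) (A : C) :
  fmap G (fmap F (idm A)) = idm (G (F A)).
Proof. by rewrite !fmap_id. Qed.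

Lemma fcomp_comp (C D E : Category) (G : Functor D E) (F : Functor C D)
    (X Y Z : C) (g : Hom Y Z) (f : Hom X Y) :
  fmap G (fmap F (g ∘ f)) = fmap G (fmap F g) ∘ fmap G (fmap F f).
Proof. by rewrite !fmap_comp. Qed.

Definition fcomp (C D E : Category) (G : Functor D E) (F : Functor C D) :
    Functor C E :=
  {| fob := fun A => G (F A);
     fmap := fun A B f => fmap G (fmap F f);
     fmap_id := fcomp_id G F;
     fmap_comp := @fcomp_comp _ _ _ G F |}.

Definition fully_faithful (C D : Category) (F : Functor C D) : Prop :=
  forall A B : C, bijective_map (fun f : Hom A B => fmap F f).

(* The identity morphism of [A], regarded as a morphism [A -> B] when the
   objects [A] and [B] are equal. *)
Definition idto (C : Category) (A B : C) (e : A = B) : Hom A B :=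
  match e in _ = B' return Hom A B' with eq_refl => idm A end.

Definition fob_eq (C D : Category) (F G : Functor C D) (e : F = G) (A : C) :
    F A = G A :=
  f_equal (fun H : Functor C D => H A) e.

Definition split_mono (C : Category) (A B : C) (m : Hom A B) : Prop :=
  exists r : Hom B A, r ∘ m = idm A.

Definition finite_type (T : Type) : Prop := exists l : list T, forall x, In x l.

Definition finite_category (J : Category) : Prop :=
  finite_type J /\ forall j k : J, finite_type (Hom j k).

Record Cone (J C : Category) (F : Functor J C) := {
  vertex : C;
  leg : forall j : J, Hom vertex (F j);
  leg_nat : forall (j k : J) (u : Hom j k), fmap F u ∘ leg j = leg k }.

Arguments leg {J C F} c j.

Definition is_limit (J C : Category) (F : Functor J C) (c : Cone F) : Prop :=
  forall x : Cone F,
    exists! h : Hom (vertex x) (vertex c), forall j, leg c j ∘ h = leg x j.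

Lemma map_cone_nat (J C D : Category) (G : Functor C D) (F : Functor J C)
    (c : Cone F) (j k : J) (u : Hom j k) :
  fmap (fcomp G F) u ∘ fmap G (leg c j) = fmap G (leg c k).
Proof. by rewrite /= -fmap_comp leg_nat. Qed.

Definition map_cone (J C D : Category) (G : Functor C D) (F : Functor J C)
    (c : Cone F) : Cone (fcomp G F) :=
  @Build_Cone J D (fcomp G F) (G (vertex c)) (fun j => fmap G (leg c j))
    (@map_cone_nat J C D G F c).

Definition cartesian_functor (C D : Category) (G : Functor C D) : Prop :=
  forall (J : Category) (F : Functor J C) (c : Cone F),
    finite_category J -> is_limit c -> is_limit (map_cone G c).

Definition is_pullback (C : Category) (P A E B : C)
    (p : Hom E B) (f : Hom A B) (u : Hom P E) (v : Hom P A) : Prop :=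
  p ∘ u = f ∘ v /\
  forall (X : C) (s : Hom X E) (t : Hom X A), p ∘ s = f ∘ t ->
    exists! h : Hom X P, u ∘ h = s /\ v ∘ h = t.

Record CartCat := {
  ccat :> Category;
  lim : forall J : Category, finite_category J ->
          forall F : Functor J ccat, Cone F;
  lim_is_limit : forall (J : Category) (fin : finite_category J)
    (F : Functor J ccat), is_limit (lim fin F) }.

Arguments lim {c J} fin F.
Arguments lim_is_limit {c J} fin F x.

(* [C] is a full subcategory of [D] through [incl], an injective-on-objects
   fully faithful functor.  Closure under the chosen finite limits of [D],
   from which the chosen limits of [C] are inherited, is the strict
   preservation of the chosen limit cones. *)
Record CartFullIncl (C D : CartCat) := {
  incl :> Functor C D;
  incl_inj : injective_map (fob incl);
  incl_ff : fully_faithful incl;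
  incl_lim : forall (J : Category) (fin : finite_category J) (F : Functor J C),
    map_cone incl (lim fin F) = lim fin (fcomp incl F) }.

Definition locally_small (C D : CartCat) (i : CartFullIncl C D)
    (E B : D) (p : Hom E B) : Prop :=
  forall (A : C) (f : Hom (i A) B),
    exists (P : C) (u : Hom (i P) E) (v : Hom (i P) (i A)),
      is_pullback p f u v.

(* Natural transformations [Hom (F -) I -> Hom (F -) X] of presheaves. *)
Record HomNat (C D : Category) (F : Functor C D) (I X : D) := {
  hn :> forall A : C, Hom (F A) I -> Hom (F A) X;
  hn_nat : forall (A B : C) (u : Hom A B) (f : Hom (F B) I),
    hn (f ∘ fmap F u) = hn f ∘ fmap F u }.

Definition postcomp (C D : Category) (F : Functor C D) (I X : D)
    (g : Hom I X) : HomNat F I X :=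
  {| hn := fun A (f : Hom (F A) I) => g ∘ f;
     hn_nat := fun A B u f => comp_assoc g f (fmap F u) |}.

Definition dense (C D : Category) (F : Functor C D) : Prop :=
  forall I X : D, bijective_map (@postcomp C D F I X).

Definition site_morphism (C D E F : CartCat)
    (i : CartFullIncl C D) (k : CartFullIncl E F) (G : Functor D F) : Prop :=
  cartesian_functor G /\
  forall (d : D) (e : E) (f : Hom (k e) (G d)),
    exists (c : C) (g : Hom (i c) d) (h : Hom (k e) (G (i c))),
      f = fmap G g ∘ h.

Record CartComonad (D : Category) := {
  box :> Functor D D;
  counit : forall A : D, Hom (box A) A;
  comult : forall A : D, Hom (box A) (box (box A));
  counit_nat : forall (A B : D) (f : Hom A B),
    f ∘ counit A = counit B ∘ fmap box f;
  comult_nat : forall (A B : D) (f : Hom A B),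
    fmap box (fmap box f) ∘ comult A = comult B ∘ fmap box f;
  counit_comult : forall A, counit (box A) ∘ comult A = idm (box A);
  map_counit_comult : forall A, fmap box (counit A) ∘ comult A = idm (box A);
  comult_assoc : forall A,
    fmap box (comult A) ∘ comult A = comult (box A) ∘ comult A;
  box_cartesian : cartesian_functor box }.

Definition box_limit (D : Category) (T : CartComonad D) (J : Category)
    (fin : finite_category J) (F : Functor J D) (c : Cone F)
    (lc : is_limit c) : is_limit (map_cone T c) :=
  @box_cartesian D T J F c fin lc.
Arguments box_limit {D} T {J} fin {F c} lc x.

Arguments counit {D} T A : rename.
Arguments comult {D} T A : rename.

Record Coalg (D : Category) (T : CartComonad D) := {
  carrier : D;
  coact : Hom carrier (T carrier);
  coact_counit : counit T carrier ∘ coact = idm carrier;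
  coact_comult : fmap T coact ∘ coact = comult T carrier ∘ coact }.

Arguments coact {D T} c.

Record CoalgHom (D : Category) (T : CartComonad D) (X Y : Coalg T) := {
  chom : Hom (carrier X) (carrier Y);
  chom_comm : fmap T chom ∘ coact X = coact Y ∘ chom }.

Section CoalgCat.
Variables (D : Category) (T : CartComonad D).

Lemma coalg_hom_eq (X Y : Coalg T) (f g : CoalgHom X Y) :
  chom f = chom g -> f = g.
Proof.
case: f => f hf; case: g => g hg /= e; subst g.
by rewrite (proof_irrelevance _ hf hg).
Qed.

Lemma coalg_id_comm (X : Coalg T) :
  fmap T (idm (carrier X)) ∘ coact X = coact X ∘ idm (carrier X).
Proof. by rewrite fmap_id comp_idl comp_idr. Qed.

Definition coalg_id (X : Coalg T) : CoalgHom X X :=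
  {| chom := idm (carrier X); chom_comm := coalg_id_comm X |}.

Lemma coalg_comp_comm (X Y Z : Coalg T) (g : CoalgHom Y Z) (f : CoalgHom X Y) :
  fmap T (chom g ∘ chom f) ∘ coact X = coact Z ∘ (chom g ∘ chom f).
Proof.
by rewrite fmap_comp -comp_assoc chom_comm !comp_assoc chom_comm.
Qed.

Definition coalg_comp (X Y Z : Coalg T) (g : CoalgHom Y Z) (f : CoalgHom X Y) :
    CoalgHom X Z :=
  {| chom := chom g ∘ chom f; chom_comm := coalg_comp_comm g f |}.

Lemma coalg_comp_idl (X Y : Coalg T) (f : CoalgHom X Y) :
  coalg_comp (coalg_id Y) f = f.
Proof. apply: coalg_hom_eq; exact: comp_idl. Qed.

Lemma coalg_comp_idr (X Y : Coalg T) (f : CoalgHom X Y) :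
  coalg_comp f (coalg_id X) = f.
Proof. apply: coalg_hom_eq; exact: comp_idr. Qed.

Lemma coalg_comp_assoc (X Y Z W : Coalg T) (h : CoalgHom Z W)
    (g : CoalgHom Y Z) (f : CoalgHom X Y) :
  coalg_comp h (coalg_comp g f) = coalg_comp (coalg_comp h g) f.
Proof. apply: coalg_hom_eq; exact: comp_assoc. Qed.

Definition CoalgCat : Category :=
  {| Ob := Coalg T; Hom := @CoalgHom D T; idm := coalg_id;
     comp := coalg_comp; comp_idl := coalg_comp_idl;
     comp_idr := coalg_comp_idr; comp_assoc := coalg_comp_assoc |}.

Definition forget : Functor CoalgCat D :=
  @Build_Functor CoalgCat D (@carrier D T) (@chom D T)
    (fun A => eq_refl) (fun A B E g f => eq_refl).

End CoalgCat.

Lemma limit_hom_ext (J C : Category) (F : Functor J C) (c : Cone F) :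
  is_limit c -> forall (X : C) (f g : Hom X (vertex c)),
  (forall j, leg c j ∘ f = leg c j ∘ g) -> f = g.
Proof.
move=> lc X f g e.
have n (j k : J) (u : Hom j k) : fmap F u ∘ (leg c j ∘ g) = leg c k ∘ g.
  by rewrite comp_assoc leg_nat.
have [h [_ hu]] := lc (@Build_Cone J C F X (fun j => leg c j ∘ g) n).
by rewrite -(hu f e) -(hu g (fun _ => eq_refl)).
Qed.

(* The chosen limit of a finite diagram of coalgebras: the chosen limit of the
   underlying diagram, with the coalgebra structure for which all legs are
   coalgebra morphisms. *)
Section CoalgLimits.
Variables (D : CartCat) (T : CartComonad D).
Variables (J : Category) (fin : finite_category J) (F : Functor J (CoalgCat T)).

Let UF : Functor J D := fcomp (forget T) F.
Let L : Cone UF := lim fin UF.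

Lemma coalg_lim_leg_nat (j k : J) (u : Hom j k) :
  fmap (fcomp T UF) u ∘ (coact (F j) ∘ leg L j) = coact (F k) ∘ leg L k.
Proof.
by rewrite comp_assoc /= (chom_comm (fmap F u)) -comp_assoc (leg_nat L u).
Qed.

Definition coalg_lim_cone : Cone (fcomp T UF) :=
  @Build_Cone J D (fcomp T UF) (vertex L) (fun j => coact (F j) ∘ leg L j)
    coalg_lim_leg_nat.

Lemma coalg_lim_coact_ex : exists h : Hom (vertex L) (T (vertex L)),
  forall j, fmap T (leg L j) ∘ h = coact (F j) ∘ leg L j.
Proof.
have [h [hh _]] := box_limit T fin (lim_is_limit fin UF) coalg_lim_cone.
by exists h.
Qed.

Definition coalg_lim_coact : Hom (vertex L) (T (vertex L)) :=
  proj1_sig (constructive_indefinite_description _ coalg_lim_coact_ex).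

Lemma coalg_lim_coactE (j : J) :
  fmap T (leg L j) ∘ coalg_lim_coact = coact (F j) ∘ leg L j.
Proof.
exact: (proj2_sig (constructive_indefinite_description _ coalg_lim_coact_ex) j).
Qed.

Lemma coalg_lim_counit : counit T (vertex L) ∘ coalg_lim_coact = idm (vertex L).
Proof.
apply: (limit_hom_ext (lim_is_limit fin UF)) => j.
by rewrite comp_assoc counit_nat -comp_assoc coalg_lim_coactE comp_assoc
  coact_counit comp_idl comp_idr.
Qed.

Lemma coalg_lim_comult :
  fmap T coalg_lim_coact ∘ coalg_lim_coact =
  comult T (vertex L) ∘ coalg_lim_coact.
Proof.
have lTT := box_limit T fin (box_limit T fin (lim_is_limit fin UF)).
apply: (limit_hom_ext lTT) => j /=.
rewrite [in LHS]comp_assoc -fmap_comp coalg_lim_coactE fmap_comp -comp_assoc.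
rewrite coalg_lim_coactE [in RHS]comp_assoc comult_nat -[in RHS]comp_assoc.
by rewrite coalg_lim_coactE !comp_assoc coact_comult.
Qed.

Definition coalg_lim_vertex : CoalgCat T :=
  {| carrier := vertex L; coact := coalg_lim_coact;
     coact_counit := coalg_lim_counit; coact_comult := coalg_lim_comult |}.

Definition coalg_lim_leg (j : J) : @Hom (CoalgCat T) coalg_lim_vertex (F j) :=
  @Build_CoalgHom D T coalg_lim_vertex (F j) (leg L j) (coalg_lim_coactE j).

Lemma coalg_lim_nat (j k : J) (u : Hom j k) :
  fmap F u ∘ coalg_lim_leg j = coalg_lim_leg k.
Proof. apply: coalg_hom_eq; exact: (leg_nat L u). Qed.

Definition coalg_lim : Cone F :=
  @Build_Cone J (CoalgCat T) F coalg_lim_vertex coalg_lim_leg coalg_lim_nat.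

Lemma coalg_lim_is_limit : is_limit coalg_lim.
Proof.
move=> x.
have [h [hh hu]] := lim_is_limit fin UF (map_cone (forget T) x).
have hc : fmap T h ∘ coact (vertex x) = coact coalg_lim_vertex ∘ h.
  apply: (limit_hom_ext (box_limit T fin (lim_is_limit fin UF))) => j /=.
  rewrite !comp_assoc -fmap_comp (hh j) coalg_lim_coactE -comp_assoc (hh j) /=.
  exact: chom_comm.
exists (@Build_CoalgHom D T (vertex x) coalg_lim_vertex h hc); split.
  move=> j; apply: coalg_hom_eq; exact: hh.
move=> g hg; apply: coalg_hom_eq; apply: hu => j /=.
by rewrite -(hg j).
Qed.

End CoalgLimits.

Definition CoalgCart (D : CartCat) (T : CartComonad D) : CartCat :=
  {| ccat := CoalgCat T; lim := @coalg_lim D T;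
     lim_is_limit := @coalg_lim_is_limit D T |}.

(* [comonad_sq] is strict equality of functors; the compatibilities with
   counits and comultiplications are equalities of morphisms, the identifications
   [i (T A) = S (i A)] of their domains and codomains being made explicit. *)
Record CartComonadIncl (C D : CartCat) (T : CartComonad C) (S : CartComonad D)
:= {
  cincl :> CartFullIncl C D;
  comonad_sq : fcomp cincl T = fcomp S cincl;
  comonad_counit : forall A : C,
    counit S (cincl A) ∘ idto (fob_eq comonad_sq A) =
    fmap cincl (counit T A);
  comonad_comult : forall A : C,
    comult S (cincl A) ∘ idto (fob_eq comonad_sq A) =
    fmap S (idto (fob_eq comonad_sq A)) ∘ idto (fob_eq comonad_sq (T A))
      ∘ fmap cincl (comult T A) }.

Definition dense_comonad_incl (C D : CartCat) (T : CartComonad C)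
    (S : CartComonad D) (i : CartComonadIncl T S) : Prop :=
  dense i /\ site_morphism i i S.

Lemma idto_nat (C D : Category) (F G : Functor C D) (e : F = G) (A B : C)
    (f : Hom A B) :
  idto (fob_eq e B) ∘ fmap F f = fmap G f ∘ idto (fob_eq e A).
Proof. by case: _ / e; rewrite /= comp_idl comp_idr. Qed.

Lemma idto_inj (C : Category) (A B E : C) (e : B = E) (f g : Hom A B) :
  idto e ∘ f = idto e ∘ g -> f = g.
Proof. by case: _ / e; rewrite /= !comp_idl. Qed.

Lemma coalg_eq (D : Category) (T : CartComonad D) (X Y : Coalg T)
    (e : carrier X = carrier Y) :
  fmap T (idto e) ∘ coact X = coact Y ∘ idto e -> X = Y.
Proof.
case: X e => X x x1 x2; case: Y => Y y y1 y2 /= e; subst Y.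
rewrite /= fmap_id comp_idl comp_idr => exy; subst y.
by rewrite (proof_irrelevance _ x1 y1) (proof_irrelevance _ x2 y2).
Qed.

Lemma coalg_eq_inv (D : Category) (T : CartComonad D) (X Y : Coalg T) :
  X = Y -> exists e : carrier X = carrier Y,
    fmap T (idto e) ∘ coact X = coact Y ∘ idto e.
Proof. by move=> <-; exists eq_refl; rewrite /= fmap_id comp_idl comp_idr. Qed.

Lemma forget_idto (D : Category) (T : CartComonad D) (X Y : CoalgCat T)
    (E : X = Y) (e : carrier X = carrier Y) : chom (idto E) = idto e.
Proof.
by case: _ / E e => e; rewrite (proof_irrelevance _ e eq_refl).
Qed.

Lemma idto_trans (C : Category) (A B E : C) (e1 : A = B) (e2 : B = E) :
  idto (eq_trans e1 e2) = idto e2 ∘ idto e1.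
Proof. by case: _ / e2; rewrite /= comp_idl. Qed.

Lemma lim_functor_irr (J : Category) (D : CartCat) (fin : finite_category J)
    (o : J -> D) (m : forall j k : J, Hom j k -> Hom (o j) (o k)) i1 c1 i2 c2 :
  let F1 := @Build_Functor J D o m i1 c1 in
  let F2 := @Build_Functor J D o m i2 c2 in
  exists e : vertex (lim fin F1) = vertex (lim fin F2),
    forall j, leg (lim fin F2) j ∘ idto e = leg (lim fin F1) j.
Proof.
rewrite (proof_irrelevance _ i2 i1) (proof_irrelevance _ c2 c1).
by exists eq_refl => j; rewrite /= comp_idr.
Qed.

Lemma cone_eq (J C : Category) (F : Functor J C) (c d : Cone F)
    (e : vertex c = vertex d) :
  (forall j, leg d j ∘ idto e = leg c j) -> c = d.
Proof.
case: c e => c l n; case: d => d l' n' /= e; subst d => h.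
have el : l' = l by apply: functional_extensionality_dep => j; rewrite -h comp_idr.
by subst l'; rewrite (proof_irrelevance _ n n').
Qed.

Lemma cone_eq_inv (J C : Category) (F : Functor J C) (c d : Cone F) :
  c = d -> exists e : vertex c = vertex d,
    forall j, leg d j ∘ idto e = leg c j.
Proof. by move=> <-; exists eq_refl => j; rewrite /= comp_idr. Qed.

Section CoalgIncl.
Variables (C D : CartCat) (T : CartComonad C) (S : CartComonad D).
Variable i : CartComonadIncl T S.

Notation sq A := (idto (fob_eq (comonad_sq i) A)).

Definition coalg_incl_coact (X : Coalg T) :
    Hom (i (carrier X)) (S (i (carrier X))) :=
  sq (carrier X) ∘ fmap i (coact X).

Lemma coalg_incl_counit (X : Coalg T) :
  counit S (i (carrier X)) ∘ coalg_incl_coact X = idm (i (carrier X)).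
Proof.
by rewrite /coalg_incl_coact comp_assoc comonad_counit -fmap_comp coact_counit
  fmap_id.
Qed.

Lemma coalg_incl_comult (X : Coalg T) :
  fmap S (coalg_incl_coact X) ∘ coalg_incl_coact X =
  comult S (i (carrier X)) ∘ coalg_incl_coact X.
Proof.
have sqa : fmap S (fmap i (coact X)) ∘ sq (carrier X) =
           sq (T (carrier X)) ∘ fmap i (fmap T (coact X)).
  exact: (eq_sym (idto_nat (comonad_sq i) (coact X))).
have ia : fmap i (comult T (carrier X)) ∘ fmap i (coact X) =
          fmap i (fmap T (coact X)) ∘ fmap i (coact X).
  by rewrite -!fmap_comp coact_comult.
rewrite /coalg_incl_coact fmap_comp [in RHS]comp_assoc comonad_comult.
rewrite -[in RHS](comp_assoc _ (fmap i (comult T _))) ia.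
rewrite -[in LHS]comp_assoc ![in LHS](comp_assoc (fmap S (fmap i _))) sqa.
by rewrite !comp_assoc.
Qed.

Definition coalg_incl_ob (X : CoalgCart T) : CoalgCart S :=
  {| carrier := i (carrier X); coact := coalg_incl_coact X;
     coact_counit := coalg_incl_counit X;
     coact_comult := coalg_incl_comult X |}.

Lemma coalg_incl_comm (X Y : CoalgCart T) (f : Hom X Y) :
  fmap S (fmap i (chom f)) ∘ coalg_incl_coact X =
  coalg_incl_coact Y ∘ fmap i (chom f).
Proof.
rewrite /coalg_incl_coact comp_assoc.
have /= <- := idto_nat (comonad_sq i) (chom f).
by rewrite -!comp_assoc -!fmap_comp chom_comm.
Qed.

Definition coalg_incl_hom (X Y : CoalgCart T) (f : Hom X Y) :
    Hom (coalg_incl_ob X) (coalg_incl_ob Y) :=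
  @Build_CoalgHom D S (coalg_incl_ob X) (coalg_incl_ob Y) (fmap i (chom f))
    (coalg_incl_comm f).

Lemma coalg_incl_id (X : CoalgCart T) :
  coalg_incl_hom (idm X) = idm (coalg_incl_ob X).
Proof. apply: coalg_hom_eq; exact: fmap_id. Qed.

Lemma coalg_incl_comp (X Y Z : CoalgCart T) (g : Hom Y Z) (f : Hom X Y) :
  coalg_incl_hom (g ∘ f) = coalg_incl_hom g ∘ coalg_incl_hom f.
Proof. apply: coalg_hom_eq; exact: fmap_comp. Qed.

Definition coalg_incl_functor : Functor (CoalgCart T) (CoalgCart S) :=
  {| fob := coalg_incl_ob; fmap := coalg_incl_hom;
     fmap_id := coalg_incl_id; fmap_comp := coalg_incl_comp |}.

Lemma coalg_incl_inj : injective_map coalg_incl_ob.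
Proof.
move=> X Y /coalg_eq_inv [] /= e.
have := incl_inj e.
case: X e => X x x1 x2; case: Y => Y y y1 y2 /= e eXY; subst Y.
rewrite (proof_irrelevance _ e eq_refl) /= fmap_id comp_idl comp_idr.
move/idto_inj/(proj1 (incl_ff i _ _)) => /= exy; subst y.
by rewrite (proof_irrelevance _ x1 y1) (proof_irrelevance _ x2 y2).
Qed.

Lemma coalg_incl_ff : fully_faithful coalg_incl_functor.
Proof.
move=> X Y; split=> [f g | g].
  move=> /(f_equal (@chom _ _ _ _)) /= /(proj1 (incl_ff i _ _)).
  exact: coalg_hom_eq.
have [f /= ef] := proj2 (incl_ff i _ _) (chom g).
have hf : fmap T f ∘ coact X = coact Y ∘ f.
  apply: (proj1 (incl_ff i _ _)); apply: (idto_inj (e := fob_eq (comonad_sq i) _)).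
  rewrite !fmap_comp !comp_assoc.
  have /= -> := idto_nat (comonad_sq i) f.
  by rewrite ef -comp_assoc; exact: (chom_comm g).
exists (@Build_CoalgHom C T X Y f hf); exact: coalg_hom_eq.
Qed.

Lemma coalg_incl_lim (J : Category) (fin : finite_category J)
    (F : Functor J (CoalgCart T)) :
  map_cone coalg_incl_functor (lim fin F) =
  lim fin (fcomp coalg_incl_functor F).
Proof.
have [e1 h1] := cone_eq_inv (incl_lim i fin (fcomp (forget T) F)).
have [e2 h2] := lim_functor_irr fin
  (fmap_id (fcomp i (fcomp (forget T) F)))
  (@fmap_comp _ _ (fcomp i (fcomp (forget T) F)))
  (fmap_id (fcomp (forget S) (fcomp coalg_incl_functor F)))
  (@fmap_comp _ _ (fcomp (forget S) (fcomp coalg_incl_functor F))).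
pose VF := fcomp (forget S) (fcomp coalg_incl_functor F).
pose e : i (vertex (lim fin (fcomp (forget T) F))) = vertex (lim fin VF) :=
  eq_trans e1 e2.
have he j : leg (lim fin VF) j ∘ idto e =
            fmap i (leg (lim fin (fcomp (forget T) F)) j).
  by rewrite /e idto_trans comp_assoc h2 h1.
have hc : fmap S (idto e) ∘ coalg_incl_coact (vertex (lim fin F)) =
          coalg_lim_coact fin (fcomp coalg_incl_functor F) ∘ idto e.
  apply: (limit_hom_ext (box_limit S fin (lim_is_limit fin VF))) => j /=.
  rewrite !comp_assoc -fmap_comp he coalg_lim_coactE -[in RHS]comp_assoc he /=.
  rewrite [coalg_incl_coact (F j)]/coalg_incl_coact.
  have /= <- := idto_nat (comonad_sq i) (leg (lim fin (fcomp (forget T) F)) j).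
  by rewrite -!comp_assoc -!fmap_comp coalg_lim_coactE.
have E := @coalg_eq D S (vertex (map_cone coalg_incl_functor (lim fin F)))
  (vertex (lim fin (fcomp coalg_incl_functor F))) e hc.
refine (@cone_eq J (CoalgCart S) _ _ _ E _) => j; apply: coalg_hom_eq.
by rewrite /= (forget_idto E e) he.
Qed.

Definition coalg_incl : CartFullIncl (CoalgCart T) (CoalgCart S) :=
  {| incl := coalg_incl_functor; incl_inj := coalg_incl_inj;
     incl_ff := coalg_incl_ff; incl_lim := coalg_incl_lim |}.

End CoalgIncl.

(* Main.v *)
From Stdlib Require Import ssreflect List ProofIrrelevance FunctionalExtensionality.
From Stdlib Require Import IndefiniteDescription.
Require Import Defs.

Set Implicit Arguments.
Unset Strict Implicit.
Unset Printing Implicit Defensive.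

(** The hypotheses enter through coalgebras of [boxD] whose carrier lies in [C].
    Such a coalgebra comes from a coalgebra of [boxC], because the inclusion is
    full and commutes with the comonads ([coalg_incl_of_carrier]); these are
    called small below.

    Since [boxD] preserves pullbacks, the forgetful functor from coalgebras
    creates them ([coalg_pullback_create], [coalg_pullback_reflect]).  A split
    mono of coalgebras has a split mono underneath, so its pullback in [D] along
    a map from a small coalgebra can be taken in [C], and then is the carrier of
    a small coalgebra which is the pullback of coalgebras.

    For density the key is [coalg_cover]: every map [h : i c -> I] of [D] into
    the carrier of a coalgebra factors through a coalgebra map [A -> I] with [A]
    small.  By the site condition the composite [i c -> I -> boxD I] factors through [boxD g] for some [g : i d -> I].  The
    structure map [I -> boxD I] is a coalgebra map to a cofree coalgebra, and in
    [D] it is a mono split by the counit, so its pullback [A] along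
    [boxD g : boxD (i d) -> boxD I] is small; the two factorizations give the
    required map [i c -> A].

    Given a natural family [phi] on maps from small coalgebras to [I], put
    [psi h = phi p ∘ s] whenever [h = p ∘ s] with [p : A -> I] such a map.  If
    also [h = p' ∘ s'], covering the pullback of [p] and [p'] by a small
    coalgebra shows that the value is the same ([coalg_nat_compat]).  Density of
    [C] in [D] turns [psi] into composition with a map [g : I -> X] of [D], and
    density once more, tested on coalgebra maps from small coalgebras, shows
    that [g] is a coalgebra map. *)

(** * Pullbacks as limits of cospans *)

Inductive cospan_ob := cospan_left | cospan_right | cospan_apex.

Definition cospan_hom (j k : cospan_ob) : Set :=
  match j, k with
  | _, cospan_apex => unit
  | cospan_left, cospan_left => unit
  | cospan_right, cospan_right => unit
  | _, _ => Empty_set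
  end.

Definition cospan_id (j : cospan_ob) : cospan_hom j j :=
  match j with
  | cospan_left => tt | cospan_right => tt | cospan_apex => tt
  end.

Definition cospan_comp (j k l : cospan_ob) :
  cospan_hom k l -> cospan_hom j k -> cospan_hom j l.
Proof. by case: j; case: k; case: l => //= - [] // []. Defined.

Lemma cospan_hom_eq (j k : cospan_ob) (a b : cospan_hom j k) : a = b.
Proof. by case: j a b; case: k => //= - [] []. Qed.

Definition Cospan : Category.
Proof.
refine (@Build_Category cospan_ob cospan_hom cospan_id cospan_comp _ _ _);
  intros; apply: cospan_hom_eq.
Defined.

Lemma cospan_finite : finite_category Cospan.
Proof.
split; first by exists (cospan_left :: cospan_right :: cospan_apex :: nil);
  case=> /=; tauto.
move=> [] [] /=; first [by exists nil; case | by exists (tt :: nil); case; left].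
Qed.

Definition cospan_l : @Hom Cospan cospan_left cospan_apex := tt.
Definition cospan_r : @Hom Cospan cospan_right cospan_apex := tt.

Section CospanFunctor.
Variables (D : Category) (E A B : D) (p : Hom E B) (f : Hom A B).

Definition cospan_fob (j : cospan_ob) : D :=
  match j with
  | cospan_left => E | cospan_right => A | cospan_apex => B
  end.

Definition cospan_fmap (j k : cospan_ob) :
    cospan_hom j k -> Hom (cospan_fob j) (cospan_fob k) :=
  match j, k return cospan_hom j k -> Hom (cospan_fob j) (cospan_fob k) with
  | cospan_left, cospan_left => fun _ => idm E
  | cospan_right, cospan_right => fun _ => idm A
  | cospan_apex, cospan_apex => fun _ => idm B
  | cospan_left, cospan_apex => fun _ => p
  | cospan_right, cospan_apex => fun _ => f
  | cospan_left, cospan_right => fun a => match a with end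
  | cospan_right, cospan_left => fun a => match a with end
  | cospan_apex, cospan_left => fun a => match a with end
  | cospan_apex, cospan_right => fun a => match a with end
  end.

Definition cospan_functor : Functor Cospan D.
Proof.
refine (@Build_Functor Cospan D cospan_fob cospan_fmap _ _).
- by case.
- by case=> [] [] [] //= [] // []; rewrite ?comp_idl ?comp_idr.
Defined.
End CospanFunctor.

Section CospanCone.
Variables (D : Category) (F : Functor Cospan D) (X : D).
Variables (s : Hom X (F cospan_left)) (t : Hom X (F cospan_right)).
Hypothesis st : fmap F cospan_l ∘ s = fmap F cospan_r ∘ t.

Definition cospan_leg (j : cospan_ob) : Hom X (F j) :=
  match j return Hom X (F j) with
  | cospan_left => s | cospan_right => t | cospan_apex => fmap F cospan_l ∘ s
  end.

Lemma cospan_leg_nat (j k : Cospan) (a : Hom j k) :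
  fmap F a ∘ cospan_leg j = cospan_leg k.
Proof.
have idE (l : Cospan) (b : Hom l l) : fmap F b ∘ cospan_leg l = cospan_leg l.
  by rewrite (cospan_hom_eq b (idm l)) fmap_id comp_idl.
move: j k a => [] [] a //.
- by rewrite (cospan_hom_eq a cospan_l).
- by rewrite (cospan_hom_eq a cospan_r).
Qed.

Definition cospan_cone : Cone F := Build_Cone cospan_leg_nat.
End CospanCone.

(** Stated for an arbitrary functor [F] rather than for [cospan_functor], so that
    it also applies to the composite of a cospan with another functor. *)
Lemma cospan_limit_pullback (D : Category) (F : Functor Cospan D) (c : Cone F) :
  is_limit c <->
  is_pullback (fmap F cospan_l) (fmap F cospan_r)
    (leg c cospan_left) (leg c cospan_right).
Proof.
split=> [lc | [_ pc] x].
  split=> [|X s t st]; first by rewrite !leg_nat.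
  have [h [hh hu]] := lc (cospan_cone st).
  exists h; split; first by split; [exact: (hh cospan_left) | exact: (hh cospan_right)].
  move=> g [gs gt]; apply: hu; case=> //=.
  by rewrite -(leg_nat c cospan_l) -comp_assoc gs.
have [|h [[hl hr] hu]] := pc _ (leg x cospan_left) (leg x cospan_right).
  by rewrite !leg_nat.
exists h; split.
  case=> //.
  by rewrite -(leg_nat c cospan_l) -(leg_nat x cospan_l) -comp_assoc hl.
by move=> g hg; apply: hu; split; apply: hg.
Qed.

Lemma pullback_exists (D : CartCat) (E A B : D) (p : Hom E B) (f : Hom A B) :
  exists (P : D) (u : Hom P E) (v : Hom P A), is_pullback p f u v.
Proof.
have /cospan_limit_pullback pb :=
  lim_is_limit cospan_finite (cospan_functor p f).
by do 3 eexists; exact: pb.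
Qed.

Lemma cartesian_pullback (C D : Category) (G : Functor C D) (P A E B : C)
    (p : Hom E B) (f : Hom A B) (u : Hom P E) (v : Hom P A) :
  cartesian_functor G -> is_pullback p f u v ->
  is_pullback (fmap G p) (fmap G f) (fmap G u) (fmap G v).
Proof.
move=> cG pb.
pose c := @cospan_cone _ (cospan_functor p f) _ u v (proj1 pb).
have lc : is_limit c by apply/cospan_limit_pullback.
exact: (proj1 (cospan_limit_pullback _) (cG _ _ _ cospan_finite lc)).
Qed.

Lemma pullback_ext (D : Category) (P A E B : D) (p : Hom E B) (f : Hom A B)
    (u : Hom P E) (v : Hom P A) (pb : is_pullback p f u v)
    (X : D) (a b : Hom X P) :
  u ∘ a = u ∘ b -> v ∘ a = v ∘ b -> a = b.
Proof.
move=> eu ev; case: pb => [sq univ].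
have [|h [_ hu]] := univ X (u ∘ b) (v ∘ b); first by rewrite !comp_assoc sq.
by rewrite -(hu a) // -(hu b).
Qed.

Lemma pullback_idto (D : Category) (P A A' E B : D) (e : A = A')
    (p : Hom E B) (f : Hom A' B) (u : Hom P E) (v : Hom P A) :
  is_pullback p (f ∘ idto e) u v -> is_pullback p f u (idto e ∘ v).
Proof. by move: f; case: _ / e => f; rewrite /= comp_idr comp_idl. Qed.

(** * Pullbacks of coalgebras *)

Section CoalgPullback.
Variables (D : Category) (S : CartComonad D).

(** The comparison map of [D] is a coalgebra map because [S] preserves the
    pullback, so that both sides are detected by [fmap S] of the projections. *)
Lemma coalg_pullback_reflect (P E A B : CoalgCat S) (p : Hom E B) (f : Hom A B)
    (u : Hom P E) (v : Hom P A) :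
  is_pullback (chom p) (chom f) (chom u) (chom v) -> is_pullback p f u v.
Proof.
move=> pb; split; first by apply: coalg_hom_eq; exact: (proj1 pb).
move=> X s t st.
have [h [[hs ht] hu]] := proj2 pb _ _ _ (f_equal (@chom _ _ _ _) st).
have hc : fmap S h ∘ coact X = coact P ∘ h.
  apply: (pullback_ext (cartesian_pullback (box_cartesian (c := S)) pb)).
    by rewrite !comp_assoc -fmap_comp hs !chom_comm -comp_assoc hs.
  by rewrite !comp_assoc -fmap_comp ht !chom_comm -comp_assoc ht.
exists (@Build_CoalgHom _ S X P h hc); split.
  by split; apply: coalg_hom_eq.
move=> g [gs gt]; apply: coalg_hom_eq; apply: hu.
by rewrite -gs -gt.
Qed.

(** The structure map of the pullback is induced by those of [E] and [A], the
    pullback being preserved by [S]; its laws hold after projection, the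
    coassociativity law because [S ∘ S] preserves the pullback as well.  The
    equation on the carrier is what places the pullback in the subcategory when
    [P] lies there. *)
Lemma coalg_pullback_create (E A B : CoalgCat S) (p : Hom E B) (f : Hom A B)
    (P : D) (u : Hom P (carrier E)) (v : Hom P (carrier A)) :
  is_pullback (chom p) (chom f) u v ->
  exists Y : CoalgCat S, carrier Y = P /\
  exists (u' : Hom Y E) (v' : Hom Y A),
    is_pullback (chom p) (chom f) (chom u') (chom v').
Proof.
move=> pb.
have pS := cartesian_pullback (box_cartesian (c := S)) pb.
have pSS := cartesian_pullback (box_cartesian (c := S)) pS.
have [|x [[xu xv] _]] := proj2 pS _ (coact E ∘ u) (coact A ∘ v).
  by rewrite !comp_assoc !chom_comm -!comp_assoc (proj1 pb).
have x1 : counit S P ∘ x = idm P.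
  apply: (pullback_ext pb).
    by rewrite comp_assoc counit_nat -comp_assoc xu comp_assoc coact_counit
      comp_idl comp_idr.
  by rewrite comp_assoc counit_nat -comp_assoc xv comp_assoc coact_counit
    comp_idl comp_idr.
have x2 : fmap S x ∘ x = comult S P ∘ x.
  apply: (pullback_ext pSS).
    rewrite [in LHS]comp_assoc -fmap_comp xu fmap_comp -comp_assoc xu.
    by rewrite [in RHS]comp_assoc comult_nat -[in RHS]comp_assoc xu !comp_assoc
      coact_comult.
  rewrite [in LHS]comp_assoc -fmap_comp xv fmap_comp -comp_assoc xv.
  by rewrite [in RHS]comp_assoc comult_nat -[in RHS]comp_assoc xv !comp_assoc
    coact_comult.
pose Y : CoalgCat S := Build_Coalg x1 x2.
exists Y; split=> //.
by exists (@Build_CoalgHom _ S Y E u xu), (@Build_CoalgHom _ S Y A v xv).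
Qed.

Definition cofree (X : D) : CoalgCat S :=
  {| carrier := S X; coact := comult S X;
     coact_counit := counit_comult S X; coact_comult := comult_assoc S X |}.

Definition cofree_hom (X Y : D) (g : Hom X Y) : Hom (cofree X) (cofree Y) :=
  @Build_CoalgHom _ S (cofree X) (cofree Y) (fmap S g) (comult_nat S g).

(** The unit of the cofree adjunction: coassociativity says that it is a
    coalgebra map. *)
Definition coact_hom (X : CoalgCat S) : Hom X (cofree (carrier X)) :=
  @Build_CoalgHom _ S X (cofree (carrier X)) (coact X) (coact_comult X).

End CoalgPullback.

(** * Dense functors *)

Lemma hom_nat_eq (D E : Category) (F : Functor D E) (I X : E)
    (m n : HomNat F I X) : (forall A f, m A f = n A f) -> m = n.
Proof.
case: m => m hm; case: n => n hn /= e.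
have emn : m = n.
  by apply: functional_extensionality_dep => A; apply: functional_extensionality.
by subst n; rewrite (proof_irrelevance _ hm hn).
Qed.

Lemma dense_hom_ext (C D : Category) (F : Functor C D) (hF : dense F) (X Y : D)
    (f g : Hom X Y) :
  (forall (c : C) (h : Hom (F c) X), f ∘ h = g ∘ h) -> f = g.
Proof. by move=> e; apply: (proj1 (hF _ _)); exact: hom_nat_eq. Qed.

(** Existence half of density, for a natural transformation presented as a
    total, single-valued, natural relation: below, the value at [h] is computed
    from a factorization of [h], and [R c h y] says that some factorization of
    [h] yields [y]. *)
Lemma dense_extend (C D : Category) (F : Functor C D) (hF : dense F) (I X : D)
    (R : forall c : C, Hom (F c) I -> Hom (F c) X -> Prop) :
  (forall c h, exists y, R c h y) ->
  (forall c h y y', R c h y -> R c h y' -> y = y') ->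
  (forall (b c : C) (u : Hom b c) h y,
     R c h y -> R b (h ∘ fmap F u) (y ∘ fmap F u)) ->
  exists g : Hom I X, forall c h y, R c h y -> g ∘ h = y.
Proof.
move=> Rex Runi Rnat.
pose psi c h := proj1_sig (constructive_indefinite_description _ (Rex c h)).
have Rpsi c h : R c h (psi c h).
  exact: proj2_sig (constructive_indefinite_description _ (Rex c h)).
have psi_nat b c (u : Hom b c) (h : Hom (F c) I) :
    psi b (h ∘ fmap F u) = psi c h ∘ fmap F u.
  exact: Runi (Rpsi _ _) (Rnat _ _ u _ _ (Rpsi _ _)).
have [g eg] := proj2 (hF I X) (Build_HomNat psi_nat).
exists g => c h y Ry.
rewrite -(Runi _ _ _ _ (Rpsi c h) Ry).
exact: (f_equal (fun n : HomNat F I X => n c h) eg).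
Qed.

(** * Coalgebras carried by objects of the subcategory *)

Lemma idto_surj (D : Category) (A B E : D) (e : B = E) (f : Hom A E) :
  exists g : Hom A B, idto e ∘ g = f.
Proof. by move: f; case: _ / e => f; exists f; rewrite /= comp_idl. Qed.

Lemma idto_fmap (D E : Category) (F : Functor D E) (A B : D) (e : A = B) :
  fmap F (idto e) = idto (f_equal (fob F) e).
Proof. by case: _ / e; exact: fmap_id. Qed.

Section Inclusion.
Variables (C D : CartCat) (T : CartComonad C) (S : CartComonad D).
Variable i : CartComonadIncl T S.

(** Fullness lifts the structure map [i P -> S (i P) = i (T P)] to [P -> T P],
    and faithfulness reflects the coalgebra laws. *)
Lemma coalg_incl_of_carrier (P : C) (Y : CoalgCart S) :
  carrier Y = i P -> exists X : CoalgCart T, coalg_incl i X = Y.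
Proof.
case: Y => Q x x1 x2 /= e; subst Q.
have [z zx] := idto_surj (fob_eq (comonad_sq i) P) x.
have [y /= yz] := proj2 (incl_ff i _ _) z.
subst z.
have y1 : counit T P ∘ y = idm P.
  apply: (proj1 (incl_ff i _ _)).
  by rewrite fmap_comp -comonad_counit -comp_assoc zx x1 fmap_id.
have y2 : fmap T y ∘ y = comult T P ∘ y.
  apply: (proj1 (incl_ff i _ _)).
  apply: (idto_inj (e := fob_eq (comonad_sq i) (T P))).
  apply: (idto_inj (e := f_equal (fob S) (fob_eq (comonad_sq i) P))).
  rewrite -!idto_fmap !fmap_comp.
  rewrite [in LHS](comp_assoc (idto _) (fmap i (fmap T y))).
  have /= -> := idto_nat (comonad_sq i) y.
  rewrite -[in LHS]comp_assoc zx comp_assoc -fmap_comp zx x2.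
  by rewrite !comp_assoc -comonad_comult -comp_assoc zx.
exists (Build_Coalg y1 y2).
apply: (@coalg_eq _ S (coalg_incl_ob i (Build_Coalg y1 y2))
  (Build_Coalg x1 x2) eq_refl).
by rewrite /= fmap_id comp_idl comp_idr /coalg_incl_coact /= zx.
Qed.

Lemma coalg_small_pullback (E A B : CoalgCart S) (p : Hom E B) (f : Hom A B)
    (P : C) (u : Hom (i P) (carrier E)) (v : Hom (i P) (carrier A)) :
  is_pullback (chom p) (chom f) u v ->
  exists (X : CoalgCart T) (u' : Hom (coalg_incl i X) E)
    (v' : Hom (coalg_incl i X) A),
    is_pullback (chom p) (chom f) (chom u') (chom v').
Proof.
move=> /coalg_pullback_create [Y [/coalg_incl_of_carrier [X <-]]] pb.
by exists X.
Qed.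

(** * Local smallness and density *)

Hypothesis hsmall :
  forall (E B : D) (m : Hom E B), split_mono m -> locally_small i m.

Lemma coalg_split_mono_small (E B : CoalgCart S) (m : Hom E B) :
  split_mono m -> locally_small (coalg_incl i) m.
Proof.
move=> [r rm] A f.
have sm : split_mono (chom m) by exists (chom r); rewrite -[RHS](f_equal (@chom _ _ _ _) rm).
have [P [u [v pbD]]] := hsmall sm (chom f).
have [X [u' [v' pb]]] := coalg_small_pullback (p := m) (f := f) pbD.
by exists X, u', v'; apply: coalg_pullback_reflect.
Qed.

Hypothesis hdense : dense_comonad_incl i.

(** Applying local smallness to the structure map of [I], which is a coalgebra map
    to a cofree coalgebra and a mono of [D] split by the counit, makes [A] small.
    The counit is no coalgebra map in general, so the smallness of split monos
    of coalgebras would not do here. *)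
Lemma coalg_cover (I : CoalgCart S) (c : C) (h : Hom (i c) (carrier I)) :
  exists (A : CoalgCart T) (p : Hom (coalg_incl i A) I)
    (s : Hom (i c) (i (carrier A))), h = chom p ∘ s.
Proof.
(* The site condition: [coact I ∘ h = fmap S g ∘ k] with [g : i d -> I]. *)
have [d [g [k hk]]] := proj2 (proj2 hdense) _ _ (coact I ∘ h).
have sm : split_mono (coact I) by exists (counit S _); exact: coact_counit.
have [P [u [v]]] :=
  hsmall sm (fmap S g ∘ idto (fob_eq (comonad_sq i) d)).
move=> /pullback_idto pb.
have [A [p [q pbA]]] :=
  coalg_small_pullback (p := coact_hom I) (f := cofree_hom S g) pb.
have [s [[ps _] _]] := proj2 pbA _ _ _ hk.
by exists A, p, s.
Qed.

(** The maps [s] and [s'] induce a map to the pullback of [p] and [p'].  This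
    pullback need not be small, so naturality of [phi] is used on a small
    coalgebra through which the induced map factors. *)
Lemma coalg_nat_compat (I X : CoalgCart S) (phi : HomNat (coalg_incl i) I X)
    (c : C) (A A' : CoalgCart T)
    (p : Hom (coalg_incl i A) I) (p' : Hom (coalg_incl i A') I)
    (s : Hom (i c) (i (carrier A))) (s' : Hom (i c) (i (carrier A'))) :
  chom p ∘ s = chom p' ∘ s' ->
  chom (phi A p) ∘ s = chom (phi A' p') ∘ s'.
Proof.
move=> e.
have [P [u [v pb]]] := pullback_exists (chom p) (chom p').
have [J [_ [u1 [v1 pbJ]]]] := coalg_pullback_create pb.
have [h [[<- <-] _]] := proj2 pbJ _ _ _ e.
have [R [r [t ->]]] := coalg_cover h.
have [a ea] : exists a, fmap (coalg_incl i) a = u1 ∘ r :=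
  proj2 (incl_ff (coalg_incl i) _ _) (u1 ∘ r).
have [b eb] : exists b, fmap (coalg_incl i) b = v1 ∘ r :=
  proj2 (incl_ff (coalg_incl i) _ _) (v1 ∘ r).
have eab : p ∘ fmap (coalg_incl i) a = p' ∘ fmap (coalg_incl i) b.
  by rewrite ea eb; apply: coalg_hom_eq; rewrite /= !comp_assoc (proj1 pbJ).
have := f_equal (@chom _ _ _ _) (f_equal (phi R) eab).
by rewrite !(hn_nat phi) ea eb /= !comp_assoc => ->.
Qed.

Lemma coalg_incl_dense : dense (coalg_incl i).
Proof.
move=> I X; split=> [g g' e | phi].
  apply: coalg_hom_eq; apply: (dense_hom_ext (proj1 hdense)) => c h.
  have [A [p [s ->]]] := coalg_cover h.
  have := f_equal (fun n : HomNat (coalg_incl i) I X => chom (n A p)) e.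
  by rewrite /= !comp_assoc => ->.
pose R c (h : Hom (i c) (carrier I)) (y : Hom (i c) (carrier X)) :=
  exists (A : CoalgCart T) (p : Hom (coalg_incl i A) I)
    (s : Hom (i c) (i (carrier A))), h = chom p ∘ s /\ y = chom (phi A p) ∘ s.
have [|||g gR] := dense_extend (proj1 hdense) (R := R).
  move=> c h; have [A [p [s hs]]] := coalg_cover h.
    by exists (chom (phi A p) ∘ s), A, p, s.
  move=> c h y y' [A [p [s [-> ->]]]] [A' [p' [s' [e ->]]]].
    exact: coalg_nat_compat.
  move=> b c u h y [A [p [s [-> ->]]]].
    by exists A, p, (s ∘ fmap i u); rewrite !comp_assoc.
have gp A (p : Hom (coalg_incl i A) I) : g ∘ chom p = chom (phi A p).
  by apply: gR; exists A, p, (idm _); rewrite !comp_idr.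
(* Small coalgebra maps [p] cover [I], and precomposed with [chom p] the two
   sides agree because [g ∘ chom p] underlies the coalgebra map [phi A p]. *)
have gc : fmap S g ∘ coact I = coact X ∘ g.
  apply: (dense_hom_ext (proj1 hdense)) => c h; have [A [p [s ->]]] := coalg_cover h.
  rewrite ![in LHS]comp_assoc -[_ ∘ coact I ∘ _]comp_assoc -chom_comm.
  rewrite comp_assoc -fmap_comp gp chom_comm.
  by rewrite -[in RHS](comp_assoc (coact X)) (comp_assoc g) gp comp_assoc.
exists (@Build_CoalgHom _ S I X g gc); apply: hom_nat_eq => A p.
apply: coalg_hom_eq; exact: gp.
Qed.

End Inclusion.

Theorem theoremA5 (C D : CartCat) (boxC : CartComonad C) (boxD : CartComonad D)
    (i : CartComonadIncl boxC boxD) (hdense : dense_comonad_incl i)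
    (hsmall : forall (E B : D) (m : Hom E B), split_mono m -> locally_small i m) :
  (forall (E B : CoalgCart boxD) (m : Hom E B),
     split_mono m -> locally_small (coalg_incl i) m) /\
  dense (coalg_incl i).
Proof.
split; [exact: coalg_split_mono_small | exact: coalg_incl_dense].
Qed.
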